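(* Suppose $\nu$ is a positive integer, $b>\nu$ and $a>0$. Then for all $x\in(0,1)$ $$ m\,x^{2a}(1-x)^{2b}\le [I_x(a,b)]^2-I_x(a,b+\nu)\,I_x(a,b-\nu)\le M\,[I_x(a,b)]^2, $$ where $$ m=\frac{[\Gamma(a+b)]^2}{[\Gamma(a+1)]^2[\Gamma(b)]^2}-\frac{\Gamma(a+b-\nu)\,\Gamma(a+b+\nu)}{[\Gamma(a+1)]^2\,\Gamma(b-\nu)\,\Gamma(b+\nu)}, $$ $$ M=\frac{(b)_{\nu}(a+b-\nu)_{\nu}-(a+b)_{\nu}(b-\nu)_{\nu}}{(b)_{\nu}(a+b-\nu)_{\nu}}. $$
   Context: For $a,b>0$ and $x\in(0,1)$, $I_x(a,b)=\dfrac{\int_0^x t^{a-1}(1-t)^{b-1}dt}{\int_0^1 t^{a-1}(1-t)^{b-1}dt}$ is the normalized incomplete beta function. $(p)_0=1$ and $(p)_n=p(p+1)\cdots(p+n-1)$ is the Pochhammer symbol. *)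

(* Defs.v *)
From mathcomp Require Import all_boot all_order all_algebra.
From mathcomp Require Import all_classical all_reals all_analysis.

Set Implicit Arguments.
Unset Strict Implicit.
Unset Printing Implicit Defensive.

Import Order.TTheory GRing.Theory Num.Theory.
Import numFieldNormedType.Exports.

Local Open Scope classical_set_scope.
Local Open Scope ring_scope.

(* All integrals are Lebesgue integrals, which covers the improper ones (the
   integrands are nonnegative on the domains). Integrating over open intervals
   keeps the conventional value of the power [0 `^ p] out of play. [Rintegral]
   returns 0 for a divergent integral, so the three functions below carry their
   usual meaning for positive parameters s, a, b only. *)

Definition Gamma (R : realType) (s : R) : R :=
  \int[lebesgue_measure]_(t in `]0, +oo[) (t `^ (s - 1) * expR (- t)).

Definition incomplete_beta (R : realType) (a b x : R) : R :=
  \int[lebesgue_measure]_(t in `]0, x[) (t `^ (a - 1) * (1 - t) `^ (b - 1)).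

Definition norm_incomplete_beta (R : realType) (a b x : R) : R :=
  incomplete_beta a b x / incomplete_beta a b 1.

Definition pochhammer (R : realType) (p : R) (n : nat) : R :=
  \prod_(k < n) (p + k%:R).

(* Main.v *)
Require Import Defs.
From mathcomp Require Import all_boot all_order all_algebra.
From mathcomp Require Import all_classical all_reals all_analysis.
From mathcomp Require Import measurable_realfun ring lra.

Set Implicit Arguments.
Unset Strict Implicit.
Unset Printing Implicit Defensive.

Import Order.TTheory GRing.Theory Num.Theory.
Import numFieldNormedType.Exports.

Local Open Scope classical_set_scope.
Local Open Scope ring_scope.

(** Write B_x(c) for the incomplete beta integral with parameters a and c, and
    y = 1 - x. Integrating the derivative of t^a (1 - t)^c gives
    (a + c) B_x(c + 1) - c B_x(c) = x^a y^c, so that, for p >= q > 0, the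
    difference I(p) I(q + 1) - I(p + 1) I(q) is a positive multiple of
    p y^-p B_x(p) - q y^-q B_x(q). Since (1 - t) / y >= 1 on (0, x), the latter
    is at least (p - q) x^a / a. Summing over p = b + k, q = b - k - 1 for
    k < nu telescopes to the lower bound; its constant m is expressed with Gamma
    by Euler's formula Gamma(a) Gamma(b) = Gamma(a + b) B_1(b).
    The upper bound is the log-convexity of B_x(c) in c, because
    1 - M = B_1(b)^2 / (B_1(b + nu) B_1(b - nu)). *)

(** * Affine change of variables for Lebesgue measure *)

Lemma preimage_affine_itvoc (R : realType) (k c u v : R) : 0 < k ->
  (fun x => k * x + c) @^-1` `]u, v] = `](u - c) / k, (v - c) / k]%classic :> set R.
Proof.
move=> k0; apply/seteqP; split => x /=; rewrite !in_itv/=;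
  by rewrite ltr_pdivrMr// ler_pdivlMr// ltrBlDr lerBrDr mulrC.
Qed.

Lemma measurable_affine (R : realType) (k c : R) :
  measurable_fun [set: measurableTypeR R]
    (fun x : measurableTypeR R => k * x + c : measurableTypeR R).
Proof.
apply: measurable_funD; last exact: measurable_cst.
by apply: measurable_funM; [exact: measurable_cst|exact: measurable_id].
Qed.

(** Lebesgue measure equals [k] times its pushforward under [k * x + c], because the two agree on
    half-open intervals and these determine the measure. *)
Lemma ge0_integral_affine (R : realType) (k c : R) (f : R -> \bar R) : 0 < k ->
  measurable_fun setT f -> (forall x, 0%E <= f x)%E ->
  (\int[lebesgue_measure]_x f x
     = k%:E * \int[lebesgue_measure]_x f (k * x + c)%R)%E.
Proof.
move=> k0 mf f0.
pose phi (x : measurableTypeR R) : measurableTypeR R := k * x + c.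
have mphi : measurable_fun setT phi by exact: measurable_affine.
pose nu :
    {measure set (measurableTypeR R) -> \bar R} :=
  pushforward (@lebesgue_measure R) phi.
pose kn := NngNum (ltW k0).
have E A : measurable A -> lebesgue_measure A = mscale kn (nu mphi) A.
  apply: lebesgue_measure_unique => X [[u v]] _ <-.
  rewrite [RHS](_ : _ =
      k%:E * lebesgue_measure `]((u - c) / k)%R, ((v - c) / k)%R]%classic)%E; last first.
    by rewrite -preimage_affine_itvoc.
  rewrite !lebesgue_measure_itv/=.
  rewrite !lte_fin ltr_pM2r ?invr_gt0// ltrD2r.
  case: ifPn => _; last by rewrite mule0.
  by rewrite -!EFinB -EFinM; congr EFin; field; rewrite gt_eqF.
transitivity (\int[mscale kn (nu mphi)]_x f x)%E.
  by apply: eq_measure_integral => A mA _; exact: E.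
rewrite ge0_integral_mscale//; congr (_ * _)%E.
rewrite ge0_integral_pushforward//.
Qed.

(** * Euler's formula for Gamma and beta in the extended reals *)

(** A divergent integral is [+oo] here, whereas [Gamma] would return 0. Euler's formula can thus
    come before finiteness and serve to prove it. *)
Definition egamma (R : realType) (s : R) : \bar R :=
  (\int[lebesgue_measure]_(t in `]0%R, +oo[) (t `^ (s - 1) * expR (- t))%:E)%E.

Definition ebeta (R : realType) (a b x : R) : \bar R :=
  (\int[lebesgue_measure]_(t in `]0%R, x[)
    (t `^ (a - 1) * (1 - t) `^ (b - 1))%:E)%E.

(** Extension by zero to the whole line lets shifts, scalings and Tonelli run without tracking
    domains. *)
Definition gamma_density (R : realType) (s t : R) : R :=
  t `^ (s - 1) * expR (- t) * \1_(`]0, +oo[%classic) t.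

Definition beta_density (R : realType) (a b t : R) : R :=
  t `^ (a - 1) * (1 - t) `^ (b - 1) * \1_(`]0, 1[%classic) t.

Lemma gamma_density_ge0 (R : realType) (s t : R) : 0 <= gamma_density s t.
Proof. by rewrite !mulr_ge0 ?powR_ge0 ?expR_ge0. Qed.

Lemma beta_density_ge0 (R : realType) (a b t : R) : 0 <= beta_density a b t.
Proof. by rewrite !mulr_ge0 ?powR_ge0. Qed.

Lemma measurable_gamma_density (R : realType) (s : R) :
  measurable_fun setT (gamma_density s).
Proof.
apply: measurable_funM; last exact: measurable_indic.
apply: measurable_funM => //.
by apply: measurableT_comp => //; exact: measurableT_comp.
Qed.

Lemma measurable_beta_integrand (R : realType) (a b : R) (D : set R) :
  measurable_fun D (fun t : R => t `^ (a - 1) * (1 - t) `^ (b - 1)).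
Proof.
apply: measurable_funTS; apply: measurable_funM => //.
apply: (measurableT_comp (measurable_powR _)) => //.
by apply: measurable_funB.
Qed.

Lemma measurable_beta_density (R : realType) (a b : R) :
  measurable_fun setT (beta_density a b).
Proof.
by apply: measurable_funM; [exact: measurable_beta_integrand|exact: measurable_indic].
Qed.

Lemma egammaE (R : realType) (s : R) :
  (egamma s = \int[lebesgue_measure]_t (gamma_density s t)%:E)%E.
Proof.
rewrite /egamma integral_mkcond; apply: eq_integral => t _.
by rewrite patchE /gamma_density indicE; case: ifPn; rewrite ?mulr1 ?mulr0.
Qed.

Lemma ebetaE (R : realType) (a b : R) :
  (ebeta a b 1 = \int[lebesgue_measure]_t (beta_density a b t)%:E)%E.
Proof.
rewrite /ebeta integral_mkcond; apply: eq_integral => t _.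
by rewrite patchE /beta_density indicE; case: ifPn; rewrite ?mulr1 ?mulr0.
Qed.

Lemma gamma_density_conv (R : realType) (a b u t : R) : 0 < u ->
  u * (gamma_density a (u * t + 0) * gamma_density b (1 * u - (u * t + 0)))
  = gamma_density (a + b) u * beta_density a b t.
Proof.
move=> u0; rewrite /gamma_density /beta_density addr0 mul1r !indicE.
rewrite (_ : u - u * t = u * (1 - t)); last by ring.
rewrite !mem_setE !in_itv/= !andbT !pmulr_rgt0// subr_gt0 u0.
have [t0|] := ltP 0 t; last by rewrite /= !(mulr0, mul0r).
have [t1|] := ltP t 1; last by rewrite /= !(mulr0, mul0r).
rewrite /= !mulr1 !powRM ?ltW ?subr_gt0//.
have -> : u `^ (a + b - 1) = u * u `^ (a - 1) * u `^ (b - 1).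
  rewrite -{2}(powRr1 (ltW u0)) -!powRD ?(gt_eqF u0) ?implybT//.
  by congr (_ `^ _); ring.
have -> : expR (- u) = expR (- (u * t)) * expR (- (u * (1 - t))).
  by rewrite -expRD; congr expR; ring.
by ring.
Qed.

Lemma gamma_density_conv0 (R : realType) (a b u s : R) : u <= 0 ->
  gamma_density a s * gamma_density b (1 * u - s) = 0.
Proof.
move=> u0; rewrite /gamma_density !indicE !mem_setE !in_itv/= !andbT mul1r subr_gt0.
have [s0|] := ltP 0 s; last by rewrite !(mulr0, mul0r).
by rewrite [s < u]ltNge (le_trans u0 (ltW s0)) !(mulr0, mul0r).
Qed.

(** Euler's argument: the product is the integral of the convolution of the two densities, and
    scaling the convolution variable by its total separates the factors. *)
Lemma egamma_mul (R : realType) (a b : R) :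
  (egamma a * egamma b = egamma (a + b) * ebeta a b 1)%E.
Proof.
rewrite !egammaE ebetaE.
set mu := lebesgue_measure.
have mg s : measurable_fun setT (EFin \o @gamma_density R s).
  apply/measurable_EFinP; exact: measurable_gamma_density.
have g0 s t : (0 <= (@gamma_density R s t)%:E)%E.
  by rewrite lee_fin gamma_density_ge0.
have mb : measurable_fun setT (EFin \o @beta_density R a b).
  apply/measurable_EFinP; exact: measurable_beta_density.
have b0 t : (0 <= (@beta_density R a b t)%:E)%E.
  by rewrite lee_fin beta_density_ge0.
have mf : measurable_fun setT (fun z : measurableTypeR R * measurableTypeR R =>
    (gamma_density a z.1 * gamma_density b (1 * z.2 - z.1))%:E).
  apply/measurable_EFinP; apply: measurable_funM.
    exact: (measurableT_comp (measurable_gamma_density a) measurable_fst).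
  apply: (measurableT_comp (measurable_gamma_density b)).
  apply: measurable_funB; last exact: measurable_fst.
  by apply: measurable_funM; [exact: measurable_cst|exact: measurable_snd].
rewrite -ge0_integralZr//; last 2 first.
- exact: mg.
- by apply: integral_ge0.
(* Shift t = u - s in the inner integral, for fixed s. *)
transitivity (\int[mu]_s \int[mu]_u
    (gamma_density a s * gamma_density b (1 * u - s))%:E)%E.
  apply: eq_integral => s _.
  rewrite (@ge0_integral_affine _ 1 (- s) (fun t => (gamma_density b t)%:E))//;
    last exact: mg.
  rewrite mul1e -ge0_integralZl//.
  apply: (measurableT_comp (mg b)).
  exact: (@measurable_affine R 1 (- s)).
rewrite (fubini_tonelli (fun z : measurableTypeR R * measurableTypeR R =>
    (gamma_density a z.1 * gamma_density b (1 * z.2 - z.1))%:E))//; last first.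
  by move=> z; rewrite lee_fin mulr_ge0 ?gamma_density_ge0.
rewrite -ge0_integralZr//; last 2 first.
- exact: mg.
- by apply: integral_ge0.
apply: eq_integral => u _ /=.
(* For u <= 0, s and u - s are never both positive, so both sides vanish. *)
have [u0|u0] := leP u 0.
  under eq_integral do rewrite gamma_density_conv0//.
  by rewrite integral0 /gamma_density indicE mem_setE in_itv/= ltNge u0 mulr0 mul0e.
(* Substitute s = u t. *)
rewrite (@ge0_integral_affine _ u 0)//; last 2 first.
- apply/measurable_EFinP; apply: measurable_funM => /=.
    exact: measurable_gamma_density.
  apply: (measurableT_comp (measurable_gamma_density b)).
  by apply: measurable_funB.
- by move=> s; rewrite lee_fin mulr_ge0 ?gamma_density_ge0.
rewrite -!ge0_integralZl//; last 3 first.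
- apply/measurable_EFinP; apply: measurable_funM => /=.
    apply: (measurableT_comp (measurable_gamma_density a)).
    exact: (@measurable_affine R u 0).
  apply: (measurableT_comp (measurable_gamma_density b)).
  apply: measurable_funB => //.
  exact: (@measurable_affine R u 0).
- by move=> s; rewrite lee_fin mulr_ge0 ?gamma_density_ge0.
- by rewrite lee_fin ltW.
by apply: eq_integral => t _; rewrite -!EFinM gamma_density_conv.
Qed.

(** * Fundamental theorem of calculus on an open interval *)

(** [f] may blow up at the endpoints, as t^(a-1) does for a < 1. The closed-interval theorem is
    applied on an exhausting sequence of compact intervals, followed by monotone convergence. *)
Lemma ge0_integral_derive_oo (R : realType) (f F : R -> R) (a b : R) : a < b ->
  {in `]a, b[, forall x, 0 <= f x} -> {in `]a, b[, continuous f} ->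
  {in `]a, b[, forall x : R, is_derive x (1 : R) F (f x)} ->
  F x @[x --> a^'+] --> F a -> F x @[x --> b^'-] --> F b ->
  (\int[lebesgue_measure]_(x in `]a, b[) (f x)%:E = (F b - F a)%:E)%E.
Proof.
move=> ab f0 cf dF Fa Fb.
(* The factor 1/3 keeps [a + d n < b - d n] for every [n], including [n = 0], where [harmonic] is
   1. *)
pose d n : R := (b - a) / 3 * harmonic n.
have d0 n : 0 < d n by rewrite mulr_gt0 ?harmonic_gt0// divr_gt0// subr_gt0.
have d3 n : d n <= (b - a) / 3.
  rewrite ler_piMr//; first by rewrite ltW// divr_gt0// subr_gt0.
  by rewrite invf_le1// ler1n.
have dcvg : d n @[n --> \oo] --> (0 : R).
  by rewrite -(mulr0 ((b - a) / 3)); apply: cvgMr; exact: cvg_harmonic.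
pose E n : set R := `[a + d n, b - d n]%classic.
have dab n : a + d n < b - d n by have := d3 n; lra.
have Eab n x : E n x -> x \in `]a, b[.
  by rewrite /E/= !in_itv/= => /andP[? ?]; have := d0 n; lra.
have EU : \bigcup_n E n = `]a, b[%classic.
  apply/seteqP; split => [x [n _ /Eab]//|x /=]; rewrite in_itv/= => /andP[ax xb].
  have e0 : 0 < Num.min (x - a) (b - x) by rewrite lt_min !subr_gt0 ax.
  have [N _ HN] := (cvgrPdist_lt _ _).1 dcvg _ e0.
  exists N => //; have := HN N (leqnn _).
  rewrite sub0r normrN gtr0_norm// lt_min /E/= in_itv/= => /andP[? ?]; lra.
rewrite -EU; apply/esym.
have intE n : (\int[lebesgue_measure]_(x in E n) (f x)%:E
    = (F (b - d n) - F (a + d n))%:E)%E.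
  have dFx x : x \in `[a + d n, b - d n] -> is_derive x (1 : R) F (f x).
    by move=> xE; apply: dF; exact: (Eab n).
  have cF : {within `[a + d n, b - d n], continuous F}.
    apply: derivable_within_continuous => x xE.
    by have [] := dFx x xE.
  have [_ Fr Fl] := (continuous_within_itvP _ (dab n)).1 cF.
  rewrite (@continuous_FTC2 _ f F)// ?EFinB//.
  - apply: continuous_in_subspaceT => x; rewrite inE => xE.
    by apply: cf; exact: (Eab n).
  - split => // x xE; have [] := dFx x _ => //.
    by apply: subset_itv_oo_cc xE.
  - move=> x xE; rewrite derive1E; have /dFx [_ ->//] : x \in `[a + d n, b - d n].
    by apply: subset_itv_oo_cc xE.
(* The integrals over [E n] tend to [F b - F a] by the one-sided limits of [F], and to the integral
   over the union by monotone convergence. *)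
apply: (@cvg_unique _ _ ((fun n => (\int[lebesgue_measure]_(x in E n) (f x)%:E)%E) @ \oo)) => //.
- rewrite (_ : (fun n => _) = EFin \o (fun n => F (b - d n) - F (a + d n))); last first.
    by apply/funext => n; rewrite intE.
  apply: cvg_EFin; first exact: nearW.
  apply: cvgB.
  + apply: (cvg_at_leftP _ _ _).1 Fb _ _; split => [n|].
      by rewrite ltrBlDr ltrDl.
    by rewrite -{2}[b]subr0; apply: cvgB => //; exact: cvg_cst.
  + apply: (cvg_at_rightP _ _ _).1 Fa _ _; split => [n|].
      by rewrite ltrDl.
    by rewrite -{2}[a]addr0; apply: cvgD => //; exact: cvg_cst.
- apply: ge0_nondecreasing_set_cvg_integral => //.
  + move=> m n mn; apply/subsetPset; apply: subset_itv; rewrite bnd_simp.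
      by rewrite lerD2l ler_pM2l ?divr_gt0 ?subr_gt0// lef_pV2 ?posrE// ler_nat.
    by rewrite lerD2l lerN2 ler_pM2l ?divr_gt0 ?subr_gt0// lef_pV2 ?posrE// ler_nat.
  + by move=> n; exact: measurable_itv.
  + move=> n; apply/measurable_EFinP.
    apply: subspace_continuous_measurable_fun; first exact: measurable_itv.
    apply: continuous_in_subspaceT => x; rewrite inE => xE.
    by apply: cf; exact: (Eab n).
  + by move=> n x /Eab xab; rewrite lee_fin f0.
Qed.

(** * Powers of t and 1 - t: derivatives, limits, integrals *)

Lemma is_derive_powR_onem (R : realType) (c t : R) : t < 1 ->
  is_derive t (1 : R) (fun t : R => (1 - t) `^ c) (- (c * (1 - t) `^ (c - 1))).
Proof.
move=> t1.
have h : is_derive t (1 : R) (fun t : R => 1 - t) (- 1).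
  by apply: is_derive_eq; rewrite add0r mul1r.
have t1' : 0 < 1 - t by rewrite subr_gt0.
have := @is_derive1_comp R (fun s => s `^ c) (fun s => 1 - s) t _ _
  (is_derive1_powR c t1') h.
by rewrite mulrN1.
Qed.

Lemma is_derive_continuous (R : realType) (f : R -> R) (t d : R) :
  is_derive t (1 : R) f d -> {for t, continuous f}.
Proof. by case=> dft _; apply/differentiable_continuous/derivable1_diffP. Qed.

Lemma continuous_powR_gt0 (R : realType) (c t : R) : 0 < t ->
  {for t, continuous (fun t : R => t `^ c)}.
Proof. by move=> t0; exact: is_derive_continuous (is_derive1_powR c t0). Qed.

Lemma continuous_powR_onem (R : realType) (c t : R) : t < 1 ->
  {for t, continuous (fun t : R => (1 - t) `^ c)}.
Proof. by move=> t1; exact: is_derive_continuous (is_derive_powR_onem c t1). Qed.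

Lemma cvg_powR_onem_left (R : realType) (c x : R) : 0 < c -> x <= 1 ->
  (1 - t) `^ c @[t --> x^'-] --> (1 - x) `^ c.
Proof.
move=> c0; rewrite le_eqVlt => /predU1P[->|x1]; last first.
  by apply: cvg_at_left_filter; exact: continuous_powR_onem.
rewrite subrr powR0 ?gt_eqF//; apply/cvg_at_leftP => u [u1 ucvg].
apply: (cvg_at_rightP (fun s => s `^ c) 0 0).1; first exact: powR_cvg0.
split=> [n|]; first by rewrite subr_gt0.
by rewrite -(subrr 1); apply: cvgB => //; exact: cvg_cst.
Qed.

Lemma ge0_integrable_EFin (R : realType) (D : set R) (f : R -> R) (r : R) :
  measurable D -> measurable_fun D f -> (forall t, D t -> 0 <= f t) ->
  (\int[lebesgue_measure]_(t in D) (f t)%:E)%E = r%:E ->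
  lebesgue_measure.-integrable D (EFin \o f).
Proof.
move=> mD mf f0 intf; apply/integrableP; split; first exact/measurable_EFinP.
under eq_integral => t /[!inE] Dt do rewrite /= ger0_norm ?f0//.
by rewrite intf ltry.
Qed.

Lemma integral_powR (R : realType) (a x : R) : 0 < a -> 0 < x ->
  (\int[lebesgue_measure]_(t in `]0%R, x[) (t `^ (a - 1))%:E)%E
    = (x `^ a / a)%:E.
Proof.
move=> a0 x0.
rewrite (@ge0_integral_derive_oo _ _ (fun t => a^-1 * t `^ a))//.
- by rewrite powR0 ?gt_eqF// mulr0 subr0 mulrC.
- by move=> t _; exact: powR_ge0.
- by move=> t; rewrite in_itv/= => /andP[t0 _]; exact: continuous_powR_gt0.
- move=> t; rewrite in_itv/= => /andP[t0 _].
  have h := is_derive1_powR a t0.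
  by apply: is_derive_eq; rewrite /GRing.scale/= mulrA mulVf ?mul1r ?gt_eqF.
- rewrite powR0 ?gt_eqF//; apply: cvgMr; exact: powR_cvg0.
- by apply: cvg_at_left_filter; apply: cvgMr; exact: continuous_powR_gt0.
Qed.

Lemma integral_powR_onem (R : realType) (c x : R) : 0 < c -> 0 < x -> x <= 1 ->
  (\int[lebesgue_measure]_(t in `]0%R, x[) (c * (1 - t) `^ (c - 1))%:E)%E
    = (1 - (1 - x) `^ c)%:E.
Proof.
move=> c0 x0 x1.
have lt1 t : t \in `]0, x[ -> t < 1.
  by rewrite in_itv/= => /andP[_ tx]; exact: lt_le_trans x1.
rewrite (@ge0_integral_derive_oo _ _ (fun t => - (1 - t) `^ c))//.
- by rewrite subr0 powR1 opprK addrC.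
- by move=> t _; rewrite mulr_ge0 ?powR_ge0// ltW.
- by move=> t /lt1 t1; apply: cvgMr; exact: continuous_powR_onem.
- move=> t /lt1 t1; have h := is_derive_powR_onem c t1.
  by apply: is_derive_eq; rewrite opprK.
- by apply: cvgN; apply: cvg_at_right_filter; apply: continuous_powR_onem.
- by apply: cvgN; exact: cvg_powR_onem_left.
Qed.

(** * Integrability and recurrence of the beta integral *)

Lemma mulr_powRB1_le1 (R : realType) (d s : R) : 0 < d -> 0 < s -> s < 1 ->
  s * s `^ (d - 1) <= 1.
Proof.
move=> d0 s0 s1; rewrite mulr_powRB1 ?(ltW s0)// -(powRr0 s).
by rewrite ger_powR ?s0 ?ltW.
Qed.

(* With p = t^a and q = (1-t)^c in [0, 1], p q <= p (1 - t) + q t. *)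
Lemma beta_integrand_le (R : realType) (a c t : R) : 0 < a -> 0 < c ->
  0 < t -> t < 1 ->
  t `^ (a - 1) * (1 - t) `^ (c - 1) <= t `^ (a - 1) + (1 - t) `^ (c - 1).
Proof.
move=> a0 c0 t0 t1.
have t1' : 0 < 1 - t by rewrite subr_gt0.
have := mulr_powRB1_le1 a0 t0 t1.
have t1'' : 1 - t < 1 by rewrite gtrBl.
have := mulr_powRB1_le1 c0 t1' t1''.
have := powR_ge0 t (a - 1); have := powR_ge0 (1 - t) (c - 1).
set p := t `^ _; set q := (1 - t) `^ _ => q0 p0 qle ple.
rewrite -subr_ge0 (_ : _ - _ = q * (1 - t * p) + p * (1 - (1 - t) * q)); last by ring.
by rewrite addr_ge0// mulr_ge0// subr_ge0.
Qed.

Lemma powR_integrable (R : realType) (a x : R) : 0 < a -> 0 < x ->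
  lebesgue_measure.-integrable `]0, x[ (EFin \o (fun t : R => t `^ (a - 1))).
Proof.
move=> a0 x0; apply: ge0_integrable_EFin (integral_powR a0 x0) => //.
- by apply: measurable_funTS; exact: measurable_powR.
- by move=> t _; exact: powR_ge0.
Qed.

Lemma powR_onem_integrable (R : realType) (c x : R) : 0 < c -> 0 < x -> x <= 1 ->
  lebesgue_measure.-integrable `]0, x[
    (EFin \o (fun t : R => c * (1 - t) `^ (c - 1))).
Proof.
move=> c0 x0 x1; apply: ge0_integrable_EFin (integral_powR_onem c0 x0 x1) => //.
- apply: measurable_funTS; apply: measurable_funM => //.
  apply: (measurableT_comp (measurable_powR _)) => //.
  by apply: measurable_funB.
- by move=> t _; rewrite mulr_ge0 ?powR_ge0 ?ltW.
Qed.

Lemma beta_integrable (R : realType) (a c x : R) : 0 < a -> 0 < c ->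
  0 < x -> x <= 1 ->
  lebesgue_measure.-integrable `]0, x[
    (EFin \o (fun t : R => t `^ (a - 1) * (1 - t) `^ (c - 1))).
Proof.
move=> a0 c0 x0 x1.
have i1 := powR_integrable a0 x0.
have i2 := powR_onem_integrable c0 x0 x1.
have i3 := integrableZl _ c^-1 i2.
have i4 := integrableD _ i1 (i3 _).
apply: le_integrable (i4 _ _) => //.
  by apply/measurable_EFinP; exact: measurable_beta_integrand.
move=> t /=; rewrite in_itv/= => /andP[t0 tx].
rewrite /= lee_fin mulrA mulVf ?gt_eqF// mul1r.
rewrite !ger0_norm ?addr_ge0 ?mulr_ge0 ?powR_ge0//.
by apply: beta_integrand_le => //; exact: lt_le_trans x1.
Qed.

Lemma beta_recurrence (R : realType) (a c x : R) : 0 < a -> 0 < c ->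
  0 < x -> x <= 1 ->
  (a + c) * incomplete_beta a (c + 1) x - c * incomplete_beta a c x
    = x `^ a * (1 - x) `^ c.
Proof.
move=> a0 c0 x0 x1; rewrite /incomplete_beta.
have c10 : 0 < c + 1 by rewrite addr_gt0.
have i1 := beta_integrable a0 c10 x0 x1.
have i2 := beta_integrable a0 c0 x0 x1.
have i3 := powR_onem_integrable c0 x0 x1.
have lt1 t : t \in `]0, x[ -> 0 < t /\ t < 1.
  by rewrite in_itv/= => /andP[t0 tx]; split=> //; exact: lt_le_trans x1.
(* The derivative of t^a (1-t)^c changes sign, while [ge0_integral_derive_oo] wants a nonnegative
   integrand. Adding c (1-t)^(c-1), the derivative of -(1-t)^c, repairs this because t^a <= 1. *)
have S : \int[lebesgue_measure]_(t in `]0, x[)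
    ((a + c) * (t `^ (a - 1) * (1 - t) `^ (c + 1 - 1))
     - c * (t `^ (a - 1) * (1 - t) `^ (c - 1)) + c * (1 - t) `^ (c - 1))
    = x `^ a * (1 - x) `^ c - (1 - x) `^ c + 1.
  rewrite /Rintegral
    (@ge0_integral_derive_oo _ _ (fun t => t `^ a * (1 - t) `^ c - (1 - t) `^ c))//.
  - by rewrite /= powR0 ?gt_eqF// subr0 powR1 mul0r sub0r opprK.
  - move=> t /lt1[t0 t1]; rewrite addrK -(mulr_powRB1 _ c0) ?subr_ge0 ?(ltW t1)//.
    have ta := mulr_powRB1_le1 a0 t0 t1.
    rewrite (_ : _ + _ = a * (1 - t) * t `^ (a - 1) * (1 - t) `^ (c - 1)
      + c * (1 - t) `^ (c - 1) * (1 - t * t `^ (a - 1))); last by ring.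
    by apply: addr_ge0; rewrite !mulr_ge0 ?powR_ge0 ?subr_ge0 ?(ltW a0) ?(ltW c0) ?(ltW t1).
  - move=> t /lt1[t0 t1].
    have C1 := @continuous_powR_gt0 R (a - 1) t t0.
    have C2 := @continuous_powR_onem R (c + 1 - 1) t t1.
    have C3 := @continuous_powR_onem R (c - 1) t t1.
    apply: cvgD; last by apply: cvgMr; exact: C3.
    by apply: cvgB; apply: cvgMr; apply: cvgM.
  - move=> t /lt1[t0 t1].
    have h1 := is_derive1_powR a t0.
    have h2 := is_derive_powR_onem c t1.
    apply: is_derive_eq; rewrite /GRing.scale/= addrK.
    by rewrite -(mulr_powRB1 _ c0) ?subr_ge0 ?(ltW t1)// -(mulr_powRB1 _ a0) ?(ltW t0)//; ring.
  - rewrite powR0 ?gt_eqF//; apply: cvgB.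
      apply: cvgM; first exact: powR_cvg0.
      by apply: cvg_at_right_filter; apply: continuous_powR_onem.
    by apply: cvg_at_right_filter; apply: continuous_powR_onem.
  - apply: cvgB; last exact: cvg_powR_onem_left.
    apply: cvgM; last exact: cvg_powR_onem_left.
    by apply: cvg_at_left_filter; apply: continuous_powR_gt0.
have mD : measurable (`]0, x[%classic : set (measurableTypeR R)).
  exact: measurable_itv.
have Z1 := integrableZl mD (a + c) i1.
have Z2 := integrableZl mD c i2.
rewrite -!RintegralZl// -RintegralB//.
(* Subtract the added term again; its integral is 1 - (1-x)^c. *)
have -> : x `^ a * (1 - x) `^ c = x `^ a * (1 - x) `^ c - (1 - x) `^ c + 1
    - \int[lebesgue_measure]_(t in `]0, x[) (c * (1 - t) `^ (c - 1)).
  by rewrite /Rintegral integral_powR_onem//=; ring.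
rewrite -S [in RHS]RintegralD//; first by rewrite [RHS]addrK.
by have := integrableB mD Z1 Z2.
Qed.

(** * Weighted difference of incomplete beta integrals *)

(** With u = s / y >= 1 each weighted power is u^r / s, and p u^p - q u^q >= (p - q) u^p >= p - q >=
    (p - q) s. *)
Lemma weighted_powR_onem_le (R : realType) (p q s y : R) :
  0 < q -> q <= p -> 0 < y -> y <= s -> s <= 1 ->
  (p - q) + q * (y `^ (- q) * s `^ (q - 1)) <= p * (y `^ (- p) * s `^ (p - 1)).
Proof.
move=> q0 qp y0 ys s1; have s0 : 0 < s by exact: lt_le_trans ys.
have u1 : 1 <= s / y by rewrite ler_pdivlMr ?mul1r.
have E r : y `^ (- r) * s `^ (r - 1) = (s / y) `^ r / s.
  rewrite powRM ?invr_ge0 ?ltW// -(powR_inv1 (ltW y0)) -powRrM mulN1r.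
  rewrite powRB ?(gt_eqF s0) ?implybT// powRr1 ?ltW//; ring.
rewrite !E.
have Q1 : 1 <= (s / y) `^ q by rewrite -(powRr0 (s / y)) ler_powR// ltW.
have QP : (s / y) `^ q <= (s / y) `^ p by rewrite ler_powR.
set Q := _ `^ q in Q1 QP *; set P := _ `^ p in QP *.
rewrite -(ler_pM2r s0) mulrDl -!mulrA mulVf ?gt_eqF// !mulr1.
clearbody P Q; clear E u1.
have h1 : (p - q) * s <= (p - q) * P.
  by rewrite ler_wpM2l ?subr_ge0// (le_trans s1)// (le_trans Q1).
have h2 : q * Q <= q * P by rewrite ler_pM2l.
have -> : p * P = (p - q) * P + q * P by rewrite -mulrDl subrK.
by rewrite lerD.
Qed.

(** Integrate [weighted_powR_onem_le] at s = 1 - t, y = 1 - x against t^(a-1). *)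
Lemma incomplete_beta_weighted_diff (R : realType) (a p q x : R) :
  0 < a -> 0 < q -> q <= p -> 0 < x -> x < 1 ->
  (p - q) * (x `^ a / a) <=
    p * ((1 - x) `^ (- p) * incomplete_beta a p x)
    - q * ((1 - x) `^ (- q) * incomplete_beta a q x).
Proof.
move=> a0 q0 qp x0 x1; rewrite lerBrDr.
have p0 := lt_le_trans q0 qp.
set y := 1 - x; have y0 : 0 < y by rewrite subr_gt0.
have mD : measurable (`]0, x[%classic : set (measurableTypeR R)).
  exact: measurable_itv.
have ip := beta_integrable a0 p0 x0 (ltW x1).
have iq := beta_integrable a0 q0 x0 (ltW x1).
have i0 := powR_integrable a0 x0.
have Zp := integrableZl mD (p * y `^ (- p)) ip.
have Zq := integrableZl mD (q * y `^ (- q)) iq.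
have Z0 := integrableZl mD (p - q) i0.
have -> : x `^ a / a = \int[lebesgue_measure]_(t in `]0, x[) (t `^ (a - 1)).
  by rewrite /Rintegral integral_powR.
rewrite /incomplete_beta !mulrA -!RintegralZl// -RintegralD//.
apply: le_Rintegral => //.
  exact: integrableD mD _ _ Z0 Zq.
move=> t /=; rewrite in_itv/= => /andP[t0 tx].
have ys : y <= 1 - t by rewrite /y lerD2l lerN2 ltW.
have s1 : 1 - t <= 1 by rewrite gerBl ltW.
have := ler_wpM2l (powR_ge0 t (a - 1)) (weighted_powR_onem_le q0 qp y0 ys s1).
by rewrite mulrDr ![t `^ _ * (_ * (_ * _))]mulrA; congr (is_true (_ <= _)); ring.
Qed.

(** * Log-convexity in the second parameter *)

Lemma incomplete_beta_ge0 (R : realType) (a c x : R) : 0 <= incomplete_beta a c x.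
Proof. by apply: Rintegral_ge0 => t _; rewrite mulr_ge0 ?powR_ge0. Qed.

(** Integrates 2 <= z + 1/z with z = l (1-t)^(p-b), using q - b = -(p - b). The free scale [l] is
    optimized afterwards, as in a proof of Cauchy-Schwarz. *)
Lemma incomplete_beta_amgm (R : realType) (a b p q x l : R) :
  0 < a -> 0 < p -> 0 < q -> p + q = 2 * b -> 0 < x -> x <= 1 -> 0 < l ->
  2 * incomplete_beta a b x <=
    l * incomplete_beta a p x + l^-1 * incomplete_beta a q x.
Proof.
move=> a0 p0 q0 pqb x0 x1 l0; have b0 : 0 < b by lra.
have mD : measurable (`]0, x[%classic : set (measurableTypeR R)).
  exact: measurable_itv.
have ib := beta_integrable a0 b0 x0 x1.
have ip := beta_integrable a0 p0 x0 x1.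
have iq := beta_integrable a0 q0 x0 x1.
have Zb := integrableZl mD 2 ib.
have Zp := integrableZl mD l ip.
have Zq := integrableZl mD l^-1 iq.
rewrite /incomplete_beta -!RintegralZl// -RintegralD//.
apply: le_Rintegral => //.
  exact: integrableD mD _ _ Zp Zq.
move=> t /=; rewrite in_itv/= => /andP[t0 tx].
have s0 : 0 < 1 - t by rewrite subr_gt0 (lt_le_trans tx).
rewrite [leLHS]mulrCA [X in _ <= X + _]mulrCA [X in _ <= _ + X]mulrCA.
rewrite -mulrDr ler_wpM2l ?powR_ge0//.
have -> : (1 - t) `^ (p - 1) = (1 - t) `^ (b - 1) * (1 - t) `^ (p - b).
  by rewrite -powRD ?(gt_eqF s0) ?implybT//; congr (_ `^ _); ring.
have -> : (1 - t) `^ (q - 1) = (1 - t) `^ (b - 1) / (1 - t) `^ (p - b).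
  by rewrite -powRB ?(gt_eqF s0) ?implybT//; congr (_ `^ _); lra.
have := powR_gt0 (p - b) s0; have := powR_ge0 (1 - t) (b - 1).
set w := _ `^ (b - 1); set r := _ `^ (p - b) => w0 r0.
rewrite (_ : _ + _ = w * (l * r + (l * r)^-1)); last first.
  by field; rewrite !gt_eqF.
rewrite mulrC ler_wpM2l//.
have lr0 : 0 < l * r by rewrite mulr_gt0.
rewrite -(ler_pM2r lr0) [leRHS]mulrDl mulVf ?gt_eqF//.
by have := sqr_ge0 (l * r - 1); set z := l * r => h; lra.
Qed.

Lemma incomplete_beta_log_convex (R : realType) (a b p q x : R) :
  0 < a -> 0 < p -> 0 < q -> p + q = 2 * b -> 0 < x -> x <= 1 ->
  incomplete_beta a b x ^+ 2 <= incomplete_beta a p x * incomplete_beta a q x.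
Proof.
move=> a0 p0 q0 pqb x0 x1.
have H := incomplete_beta_amgm a0 p0 q0 pqb x0 x1.
have := incomplete_beta_ge0 a b x.
have := incomplete_beta_ge0 a p x.
have := incomplete_beta_ge0 a q x.
move: H; set B := incomplete_beta a b x; set P := incomplete_beta a p x.
set Q := incomplete_beta a q x => H Q0 P0; clearbody B P Q.
rewrite le_eqVlt => /predU1P[<-|B0]; first by rewrite expr0n/= mulr_ge0.
have [P0'|Pn0] := eqVneq P 0.
  (* If P = 0, this scale gives 2 B <= B Q / (Q + 1), impossible for B > 0. *)
  have l0 : 0 < (Q + 1) / B by rewrite divr_gt0// ltr_wpDl.
  have := H _ l0; rewrite P0' mulr0 add0r mul0r invf_div mulrAC.
  rewrite ler_pdivlMr ?ltr_wpDl// => h; exfalso.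
    have : 0 <= B * Q by rewrite mulr_ge0// ltW.
    lra.
have P0'' : 0 < P by rewrite lt_def Pn0.
(* The scale l = B / P turns the bound into 2 B <= B + P Q / B. *)
have := H _ (divr_gt0 B0 P0''); rewrite invf_div -mulrA mulVf// mulr1.
rewrite -lerBlDl mulrAC ler_pdivlMr// => h.
by rewrite expr2; lra.
Qed.

(** * Positivity and finiteness of Gamma *)

(** This is the total mass of the exponential law of rate 1. *)
Lemma egamma1 (R : realType) : egamma 1 = 1%E :> \bar R.
Proof.
have := @integral_exponential_pdf R 1 ltr01.
rewrite /egamma integral_itv_obnd_cbnd => [<-|]; last first.
  apply/measurable_EFinP; apply: measurable_funTS; apply: measurable_funM => //.
  by apply: measurableT_comp => //; exact: measurableT_comp.
rewrite integral_mkcond; apply: eq_integral => t _.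
rewrite /exponential_pdf !patchE; case: ifPn => // _.
by rewrite subrr powRr0 !mul1r mulN1r.
Qed.

(** On (0, 1) the exponential is at least exp(-1), so the integral is at least exp(-1) / a. *)
Lemma egamma_gt0 (R : realType) (a : R) : 0 < a -> (0 < egamma a)%E.
Proof.
move=> a0; apply: (@lt_le_trans _ _ (expR (- 1) * (1 `^ a / a))%:E).
  by rewrite lte_fin !mulr_gt0 ?expR_gt0 ?powR_gt0 ?invr_gt0.
rewrite EFinM -integral_powR// -ge0_integralZl_EFin ?expR_ge0//; last 2 first.
- by move=> t _; rewrite lee_fin powR_ge0.
- by apply/measurable_EFinP; apply: measurable_funTS; exact: measurable_powR.
have mg (D : set R) : measurable_fun D (fun t : R => (t `^ (a - 1) * expR (- t))%:E).
  apply/measurable_EFinP; apply: measurable_funTS; apply: measurable_funM => //.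
  by apply: measurableT_comp => //; exact: measurableT_comp.
have g0 t : (0 <= (t `^ (a - 1) * expR (- t))%:E)%E.
  by rewrite lee_fin mulr_ge0 ?powR_ge0 ?expR_ge0.
apply: (@le_trans _ _ (\int[lebesgue_measure]_(t in `]0%R, 1%R[)
    (t `^ (a - 1) * expR (- t))%:E)%E).
  apply: ge0_le_integral => //.
  - by move=> t _; rewrite lee_fin mulr_ge0 ?powR_ge0 ?expR_ge0.
  - apply/measurable_EFinP; apply: measurable_funTS; apply: measurable_funM => //.
  - exact: mg.
  - move=> t /=; rewrite in_itv/= => /andP[t0 t1]; rewrite lee_fin mulrC.
    by rewrite ler_wpM2l ?powR_ge0// ler_expR lerN2 ltW.
apply: ge0_subset_integral => //; first exact: mg.
by move=> t /=; rewrite !in_itv/= andbT => /andP[].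
Qed.

Lemma ebetaEFin (R : realType) (a b x : R) : 0 < a -> 0 < b -> 0 < x -> x <= 1 ->
  (ebeta a b x = (incomplete_beta a b x)%:E)%E.
Proof.
move=> a0 b0 x0 x1; rewrite /incomplete_beta /Rintegral fineK//.
apply: integrable_fin_num => //.
exact: beta_integrable.
Qed.

Lemma ebeta_1r (R : realType) (a : R) : 0 < a -> ebeta a 1 1 = (a^-1)%:E.
Proof.
move=> a0; have -> : a^-1 = 1 `^ a / a by rewrite powR1 mul1r.
rewrite -integral_powR//.
by apply: eq_integral => t _; rewrite subrr powRr0 mulr1.
Qed.

(** Euler's formula with second argument 1, where the beta integral is 1 / a, replaces integration
    by parts. *)
Lemma egamma_recurrence (R : realType) (a : R) : 0 < a ->
  (egamma a = egamma (a + 1) * (a^-1)%:E)%E.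
Proof. by move=> a0; rewrite -ebeta_1r// -egamma_mul egamma1 mule1. Qed.

Lemma egamma_natS_lty (R : realType) (n : nat) : (egamma (n.+1%:R : R) < +oo)%E.
Proof.
elim: n => [|n IH]; first by rewrite egamma1 ltry.
rewrite ltey; apply/eqP => goo.
move: IH; rewrite egamma_recurrence ?ltr0n// natr1 goo gt0_mulye ?ltxx//.
Qed.

(** Take an integer N > a. If Gamma(a) were infinite, so would be Gamma(a) Gamma(N - a) = Gamma(N)
    B(a, N - a), whose right side is finite. *)
Lemma egamma_fin_num (R : realType) (a : R) : 0 < a -> egamma a \is a fin_num.
Proof.
move=> a0; rewrite fin_numElt (lt_trans (ltNyr 0) (egamma_gt0 a0))/=.
rewrite ltey; apply/eqP => goo.
pose n := Num.truncn a.
have na : 0 < n.+1%:R - a by rewrite subr_gt0 truncnS_gt.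
have := egamma_mul a (n.+1%:R - a).
rewrite goo gt0_mulye ?egamma_gt0// subrKC ebetaEFin//.
have := egamma_natS_lty R n.
have : egamma (n.+1%:R : R) \is a fin_num.
  by rewrite fin_numElt egamma_natS_lty andbT (lt_trans (ltNyr 0) (egamma_gt0 _)).
by move=> /fineK <- _; rewrite -EFinM.
Qed.

Lemma Gamma_gt0 (R : realType) (a : R) : 0 < a -> 0 < Gamma a.
Proof.
by move=> a0; apply: fine_gt0; rewrite egamma_gt0// ltey_eq egamma_fin_num.
Qed.

Lemma EFin_Gamma (R : realType) (a : R) : 0 < a -> egamma a = (Gamma a)%:E.
Proof. by move=> a0; rewrite -(fineK (egamma_fin_num a0)). Qed.

Lemma Gamma_recurrence (R : realType) (a : R) : 0 < a ->
  Gamma (a + 1) = a * Gamma a.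
Proof.
move=> a0; have := egamma_recurrence a0.
rewrite !EFin_Gamma ?addr_gt0// -EFinM => -[->].
by rewrite mulrCA divff ?mulr1 ?gt_eqF.
Qed.

Lemma Gamma_mul (R : realType) (a b : R) : 0 < a -> 0 < b ->
  Gamma a * Gamma b = Gamma (a + b) * incomplete_beta a b 1.
Proof.
move=> a0 b0; have := egamma_mul a b.
by rewrite !EFin_Gamma ?addr_gt0// ebetaEFin// -!EFinM => -[].
Qed.

(** * Complete beta integrals and Pochhammer symbols *)

Lemma beta_gt0 (R : realType) (a b : R) : 0 < a -> 0 < b ->
  0 < incomplete_beta a b 1.
Proof.
move=> a0 b0; rewrite -(pmulr_rgt0 _ (Gamma_gt0 (addr_gt0 a0 b0))) -Gamma_mul//.
by rewrite mulr_gt0 ?Gamma_gt0.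
Qed.

Lemma beta_succ (R : realType) (a c : R) : 0 < a -> 0 < c ->
  (a + c) * incomplete_beta a (c + 1) 1 = c * incomplete_beta a c 1.
Proof.
move=> a0 c0; apply/eqP; rewrite -subr_eq0 beta_recurrence//.
by rewrite subrr powR0 ?mulr0 //= gt_eqF.
Qed.

Lemma pochhammerS (R : realType) (c : R) (n : nat) :
  pochhammer c n.+1 = pochhammer c n * (c + n%:R).
Proof. by rewrite /pochhammer big_ord_recr. Qed.

(** Iterates [beta_succ]. Taken at c = b and at c = b - n, it turns the Pochhammer quotient 1 - M
    into a quotient of complete beta integrals. *)
Lemma beta_addn (R : realType) (a c : R) (n : nat) : 0 < a -> 0 < c ->
  incomplete_beta a (c + n%:R) 1 * pochhammer (a + c) n
    = incomplete_beta a c 1 * pochhammer c n.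
Proof.
move=> a0 c0; elim: n => [|n IH]; first by rewrite addr0 /pochhammer !big_ord0.
rewrite !pochhammerS mulrA [RHS]mulrA -IH.
have cn0 : 0 < c + n%:R by rewrite ltr_wpDr.
have := beta_succ a0 cn0; rewrite -addrA natr1 => E.
by rewrite mulrAC [RHS]mulrAC -[a + c + _]addrA [_ * (a + _)]mulrC E [_ * (c + _)]mulrC.
Qed.

Lemma pochhammer_gt0 (R : realType) (c : R) (n : nat) : 0 < c -> 0 < pochhammer c n.
Proof. by move=> c0; apply: prodr_gt0 => i _; rewrite ltr_wpDr. Qed.

(** * Lower and upper bounds for the normalized function *)

Lemma norm_incomplete_beta_succ (R : realType) (a c x : R) : 0 < a -> 0 < c ->
  0 < x -> x <= 1 ->
  norm_incomplete_beta a (c + 1) x = norm_incomplete_beta a c x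
    + x `^ a * (1 - x) `^ c / (c * incomplete_beta a c 1).
Proof.
move=> a0 c0 x0 x1; rewrite /norm_incomplete_beta.
have N0 := beta_gt0 a0 c0.
have N1 : incomplete_beta a (c + 1) 1 = c * incomplete_beta a c 1 / (a + c).
  by rewrite -beta_succ// mulrAC divff ?mul1r// gt_eqF// addr_gt0.
rewrite N1 -(beta_recurrence a0 c0 x0 x1).
by field; rewrite !gt_eqF ?addr_gt0.
Qed.

(** Expanding I(p + 1) and I(q + 1) by [norm_incomplete_beta_succ] cancels I(p) I(q) and leaves a
    positive multiple of the difference bounded in [incomplete_beta_weighted_diff]. *)
Lemma norm_incomplete_beta_step (R : realType) (a p q x : R) :
  0 < a -> 0 < q -> q <= p -> 0 < x -> x < 1 ->
  (x `^ a) ^+ 2 * (1 - x) `^ (p + q + 1) / a ^+ 2 *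
    ((incomplete_beta a p 1 * incomplete_beta a (q + 1) 1)^-1
     - (incomplete_beta a (p + 1) 1 * incomplete_beta a q 1)^-1)
  <= norm_incomplete_beta a p x * norm_incomplete_beta a (q + 1) x
     - norm_incomplete_beta a (p + 1) x * norm_incomplete_beta a q x.
Proof.
move=> a0 q0 qp x0 x1; have p0 := lt_le_trans q0 qp.
have y0 : 0 < 1 - x by rewrite subr_gt0.
have y1 : 1 - x <= 1 by rewrite gerBl ltW.
have := incomplete_beta_weighted_diff a0 q0 qp x0 x1; rewrite !powRN => H.
have P10 := beta_gt0 a0 p0; have Q10 := beta_gt0 a0 q0.
have EP := beta_succ a0 p0; have EQ := beta_succ a0 q0.
rewrite !(norm_incomplete_beta_succ a0 _ x0 (ltW x1))// /norm_incomplete_beta.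
have -> : (1 - x) `^ (p + q + 1) = (1 - x) `^ p * (1 - x) `^ q * (1 - x).
  by rewrite -{4}(powRr1 (ltW y0)) -!powRD ?(gt_eqF y0) ?implybT.
have yp0 := powR_gt0 p y0; have yq0 := powR_gt0 q y0.
have xa0 := powR_gt0 a x0.
have -> : incomplete_beta a (p + 1) 1 = p * incomplete_beta a p 1 / (a + p).
  by rewrite -EP mulrAC divff ?mul1r// gt_eqF// addr_gt0.
have -> : incomplete_beta a (q + 1) 1 = q * incomplete_beta a q 1 / (a + q).
  by rewrite -EQ mulrAC divff ?mul1r// gt_eqF// addr_gt0.
clear EP EQ.
move: (incomplete_beta a p x) (incomplete_beta a q x) H => P Q H.
move: (incomplete_beta a p 1) (incomplete_beta a q 1) P10 Q10 => P1 Q1 P10 Q10.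
move: (x `^ a) xa0 ((1 - x) `^ p) ((1 - x) `^ q) yp0 yq0 H
  => X X0 Yp Yq Yp0 Yq0 H.
move: (1 - x) y0 y1 => y y0 y1.
have K0 : 0 < X * Yp * Yq / (p * q * P1 * Q1).
  by rewrite divr_gt0 ?mulr_gt0.
have K1 := ler_wpM2l (ltW K0) H.
apply: (@le_trans _ _ (X * Yp * Yq / (p * q * P1 * Q1) * ((p - q) * (X / a)))).
  (* The stated bound carries one extra factor y <= 1. It makes the exponent p + q + 1, which is 2 b
     in every step of the later sum. *)
  rewrite [leLHS](_ : _ =
    X * Yp * Yq / (p * q * P1 * Q1) * ((p - q) * (X / a)) * y).
    rewrite ler_piMr// mulr_ge0 ?(ltW K0)// mulr_ge0 ?subr_ge0//.
    by rewrite ltW// divr_gt0.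
  by field; rewrite !gt_eqF ?addr_gt0.
apply: (le_trans K1); rewrite le_eqVlt; apply/orP; left; apply/eqP.
by field; rewrite !gt_eqF ?addr_gt0.
Qed.

Lemma norm_incomplete_beta_turan_lower (R : realType) (a b x : R) (n : nat) :
  0 < a -> n%:R < b -> 0 < x -> x < 1 ->
  (x `^ a) ^+ 2 * (1 - x) `^ (2 * b) / a ^+ 2 *
    ((incomplete_beta a b 1 ^+ 2)^-1
     - (incomplete_beta a (b + n%:R) 1 * incomplete_beta a (b - n%:R) 1)^-1)
  <= norm_incomplete_beta a b x ^+ 2
     - norm_incomplete_beta a (b + n%:R) x * norm_incomplete_beta a (b - n%:R) x.
Proof.
move=> a0 + x0 x1; elim: n => [|n IH] nb.
  by rewrite addr0 subr0 -!expr2 !subrr mulr0.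
have nb' : n%:R < b by apply: le_lt_trans nb; rewrite ler_nat.
have q0 : 0 < b - n.+1%:R by rewrite subr_gt0.
have qp : b - n.+1%:R <= b + n%:R.
  by rewrite lerD2l; apply: (@le_trans _ _ 0); rewrite ?oppr_le0.
(* With p = b + n and q = b - n - 1 the reciprocals of the complete integrals telescope along with
   the products of [norm_incomplete_beta]. *)
have := norm_incomplete_beta_step a0 q0 qp x0 x1.
have -> : b - n.+1%:R + 1 = b - n%:R by rewrite -natr1; ring.
have -> : b + n%:R + 1 = b + n.+1%:R by rewrite -natr1; ring.
have -> : b + n%:R + (b - n.+1%:R) + 1 = 2 * b by rewrite -natr1; ring.
move=> S; have := lerD (IH nb') S.
by rewrite -mulrDr ![_ - _ + (_ - _)]addrA !subrK.
Qed.

Lemma norm_incomplete_beta_turan_upper (R : realType) (a b x : R) (n : nat) :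
  0 < a -> n%:R < b -> 0 < x -> x < 1 ->
  pochhammer (a + b) n * pochhammer (b - n%:R) n
    / (pochhammer b n * pochhammer (a + b - n%:R) n)
    * norm_incomplete_beta a b x ^+ 2
  <= norm_incomplete_beta a (b + n%:R) x * norm_incomplete_beta a (b - n%:R) x.
Proof.
move=> a0 nb x0 x1.
have b0 : 0 < b by exact: le_lt_trans nb.
have q0 : 0 < b - n%:R by rewrite subr_gt0.
have p0 : 0 < b + n%:R by rewrite ltr_wpDr.
have pq : b + n%:R + (b - n%:R) = 2 * b by ring.
have := incomplete_beta_log_convex a0 p0 q0 pq x0 (ltW x1).
have EU := beta_addn n a0 b0.
(* Starting from b - n, the n shifts end at b. *)
have := beta_addn n a0 q0; rewrite subrK addrA => EV.
have U0 := beta_gt0 a0 p0; have V0 := beta_gt0 a0 b0; have W0 := beta_gt0 a0 q0.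
have al0 := pochhammer_gt0 n (addr_gt0 a0 b0).
have be0 := pochhammer_gt0 n b0.
have be0' := pochhammer_gt0 n q0.
have al0' : 0 < pochhammer (a + b - n%:R) n.
  by apply: pochhammer_gt0; rewrite -addrA addr_gt0.
rewrite /norm_incomplete_beta.
move: (incomplete_beta a b 1) (incomplete_beta a (b + n%:R) 1)
  (incomplete_beta a (b - n%:R) 1) EU EV U0 V0 W0 => V U W EU EV U0 V0 W0.
move: (pochhammer (a + b) n) (pochhammer b n) (pochhammer (b - n%:R) n)
  (pochhammer (a + b - n%:R) n) EU EV al0 be0 be0' al0'
  => al be be' al' EU EV al0 be0 be0' al0'.
move: (incomplete_beta a b x) (incomplete_beta a (b + n%:R) x)
  (incomplete_beta a (b - n%:R) x) => B P Q H.
(* Eliminating [al] and [be'] reduces the Pochhammer quotient to V^2 / (U W), so both sides share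
   the denominator U W. *)
have -> : al = V * be / U by rewrite -EU mulrAC divff ?mul1r// gt_eqF.
have -> : be' = V * al' / W by rewrite EV mulrAC divff ?mul1r// gt_eqF.
rewrite [leLHS](_ : _ = B ^+ 2 / (U * W)); last first.
  by field; rewrite !gt_eqF.
rewrite [leRHS](_ : _ = P * Q / (U * W)); last first.
  by field; rewrite !gt_eqF.
by rewrite ler_pM2r// invr_gt0 mulr_gt0.
Qed.

Theorem corollary6 (R : realType) (nu : nat) (a b : R)
    (nu_gt0 : (0 < nu)%N) (b_gt_nu : nu%:R < b) (a_gt0 : 0 < a) :
  let I (b' x : R) := norm_incomplete_beta a b' x in
  let m : R :=
    Gamma (a + b) ^+ 2 / (Gamma (a + 1) ^+ 2 * Gamma b ^+ 2)
    - Gamma (a + b - nu%:R) * Gamma (a + b + nu%:R)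
      / (Gamma (a + 1) ^+ 2 * Gamma (b - nu%:R) * Gamma (b + nu%:R)) in
  let M : R :=
    (pochhammer b nu * pochhammer (a + b - nu%:R) nu
     - pochhammer (a + b) nu * pochhammer (b - nu%:R) nu)
    / (pochhammer b nu * pochhammer (a + b - nu%:R) nu) in
  forall x : R, 0 < x -> x < 1 ->
    m * x `^ (2 * a) * (1 - x) `^ (2 * b)
      <= I b x ^+ 2 - I (b + nu%:R) x * I (b - nu%:R) x
    /\ I b x ^+ 2 - I (b + nu%:R) x * I (b - nu%:R) x <= M * I b x ^+ 2.
Proof.
move=> I m M x x0 x1.
have b0 : 0 < b by exact: le_lt_trans b_gt_nu.
have q0 : 0 < b - nu%:R by rewrite subr_gt0.
have p0 : 0 < b + nu%:R by rewrite ltr_wpDr.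
have betaE c : 0 < c -> incomplete_beta a c 1 = Gamma a * Gamma c / Gamma (a + c).
  move=> c0; rewrite Gamma_mul// mulrAC divff ?mul1r// gt_eqF//.
  by rewrite Gamma_gt0// addr_gt0.
split.
  apply: le_trans (norm_incomplete_beta_turan_lower a_gt0 b_gt_nu x0 x1).
  (* The two constants are equal: Euler's formula rewrites the beta integrals, and Gamma(a + 1) = a
     Gamma(a) absorbs the factor 1 / a^2. *)
  rewrite le_eqVlt; apply/orP; left; apply/eqP.
  have -> : x `^ (2 * a) = (x `^ a) ^+ 2.
    by rewrite expr2 -powRD ?(gt_eqF x0) ?implybT//; congr (_ `^ _); ring.
  rewrite /m !betaE// Gamma_recurrence// !addrA.
  have G0 := Gamma_gt0 a_gt0.
  have G1 := Gamma_gt0 b0; have G2 := Gamma_gt0 q0; have G3 := Gamma_gt0 p0.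
  have G4 := Gamma_gt0 (addr_gt0 a_gt0 b0).
  have := Gamma_gt0 (addr_gt0 a_gt0 q0); have := Gamma_gt0 (addr_gt0 a_gt0 p0).
  rewrite !addrA => G5 G6.
  by field; rewrite !gt_eqF.
have al0 := pochhammer_gt0 nu b0.
have be0 : 0 < pochhammer (a + b - nu%:R) nu.
  by apply: pochhammer_gt0; rewrite -addrA addr_gt0.
have := norm_incomplete_beta_turan_upper a_gt0 b_gt_nu x0 x1.
(* M is 1 minus the Pochhammer quotient, so the claim is the upper-bound lemma subtracted from
   I(b)^2. *)
rewrite /M mulrBl divff ?gt_eqF ?mulr_gt0// mulrBl mul1r => H.
by rewrite lerD2l lerN2.
Qed.
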